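(* Let $\Bbbk$ be a field and let $\psi:C\to D$ be a morphism of $\Bbbk$-coalgebras. Then the coinduction functor $\psi^*=(-)\square_D C:\mathcal{M}^D\to\mathcal{M}^C$ is semiseparable if and only if $\psi$ is a regular morphism of $D$-bicomodules, if and only if there is a $D$-bicomodule morphism $\chi:D\to C$ such that $\varepsilon_C\circ\chi\circ\psi=\varepsilon_C$.
   Context: Coalgebras are coassociative and counital over $\Bbbk$, with counit of $C$ denoted $\varepsilon_C$; $\mathcal{M}^C$ is the category of right $C$-comodules. $C$ is a $D$-bicomodule via $(\psi\otimes C)\circ\Delta_C$ and $(C\otimes\psi)\circ\Delta_C$; $D$ is a $D$-bicomodule via $\Delta_D$. For a right $D$-comodule $N$ and a left $D$-comodule $L$, the cotensor product $N\square_D L$ is the kernel of $\rho_N\otimes L-N\otimes\rho_L:N\otimes L\to N\otimes D\otimes L$. For $N\in\mathcal{M}^D$, $N\square_DC$ is a right $C$-comodule via the coaction induced by $N\otimes\Delta_C$. For a functor $F:\mathcal{C}\to\mathcal{D}$ let $\mathcal{F}^F:\mathrm{Hom}_{\mathcal{C}}(-,-)\to\mathrm{Hom}_{\mathcal{D}}(F-,F-)$ be the natural transformation (of functors $\mathcal{C}^{\mathrm{op}}\times\mathcal{C}\to\mathsf{Set}$) with $\mathcal{F}^F_{X,Y}(f)=F(f)$. $F$ is semiseparable if there is a natural transformation $\mathcal{P}^F:\mathrm{Hom}_{\mathcal{D}}(F-,F-)\to\mathrm{Hom}_{\mathcal{C}}(-,-)$ with $\mathcal{F}^F\circ\mathcal{P}^F\circ\mathcal{F}^F=\mathcal{F}^F$.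 A morphism $f$ in a category is regular if there is a morphism $g$ in that category with $f\circ g\circ f=f$. *)

(* Defs.v *)
From HB Require Import structures.
From mathcomp Require Import all_boot all_algebra.
From mathcomp Require Import boolp classical_sets.
From mathcomp Require Import freeg.

Set Implicit Arguments.
Unset Strict Implicit.
Unset Printing Implicit Defensive.

Import GRing.Theory.
Local Open Scope ring_scope.
Local Open Scope quotient_scope.

Section Linear.
Context {k : fieldType}.
Implicit Types U V W X : lmodType k.

Definition mklin U V (f : U -> V) (lf : linear f) : {linear U -> V} :=
  HB.pack f (GRing.isLinear.Build k U V *:%R f lf).

Definition mkbilin U V W (f : U -> V -> W)
    (lf : bilinear_for *:%R *:%R f) : {bilinear U -> V -> W} :=
  HB.pack f (bilinear_isBilinear.Build k U V W *:%R *:%R f lf).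

Lemma lin_eq U V (f g : {linear U -> V}) : f =1 g -> f = g.
Proof.
case: f => f [[fD] [fZ]]; case: g => g [[gD] [gZ]] /= /funext fg.
subst g; congr (GRing.Linear.Pack (GRing.Linear.Class _ _)).
  by congr (GRing.isNmodMorphism.Axioms_ _); exact: Prop_irrelevance.
by congr (GRing.isScalable.Axioms_ _); exact: Prop_irrelevance.
Qed.

End Linear.

(* The tensor product: the free vector space on [V * W] modulo the subspace
   spanned by the bilinearity relations. *)
Section Tensor.
Context {k : fieldType}.
Variables V W : lmodType k.

Definition fpair (v : V) (w : W) : {freeg (V * W)%type / k} := << (v, w) >>.

Inductive bilin_rel : {freeg (V * W)%type / k} -> Prop :=
| bilin_rel0 : bilin_rel 0
| bilin_relP a x y : bilin_rel x -> bilin_rel y -> bilin_rel (a *: x + y)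
| bilin_rel_l a v v' w :
    bilin_rel (fpair (a *: v + v') w - (a *: fpair v w + fpair v' w))
| bilin_rel_r a v w w' :
    bilin_rel (fpair v (a *: w + w') - (a *: fpair v w + fpair v w')).

Definition bilin_pred : {pred {freeg (V * W)%type / k}} :=
  fun x => `[< bilin_rel x >].

Lemma bilin_predP : submod_closed bilin_pred.
Proof.
split; first by apply/asboolP; exact: bilin_rel0.
by move=> a x y /asboolP ? /asboolP ?; apply/asboolP; exact: bilin_relP.
Qed.

HB.instance Definition _ :=
  GRing.isSubmodClosed.Build k _ bilin_pred bilin_predP.

Definition tensor : Type := Quotient.quot bilin_pred.
HB.instance Definition _ := EqQuotient.on tensor.
HB.instance Definition _ := Choice.on tensor.
HB.instance Definition _ := GRing.Zmodule.on tensor.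
HB.instance Definition _ := @isZmodQuotient.Build _ (Quotient.equiv bilin_pred)
  0 -%R +%R tensor (@pi_zeror _ _ _ _ _ (Quotient.quot bilin_pred))
  (@pi_oppr _ _ _ _ _ (Quotient.quot bilin_pred))
  (@pi_addr _ _ _ _ _ (Quotient.quot bilin_pred)).

Lemma tensor_eqP (x y : {freeg (V * W)%type / k}) :
  bilin_rel (x - y) <-> \pi_tensor x = \pi_tensor y.
Proof.
have := Quotient.idealrBE bilin_pred x y; rewrite -topredE /= => E.
by split=> [r|r]; [apply/eqP; rewrite -E|
  apply/asboolP; rewrite -[X in is_true X]/(bilin_pred (x - y)) E; apply/eqP];
  rewrite //; apply/asboolP.
Qed.

Definition tensor_scale (a : k) (x : tensor) : tensor :=
  \pi_tensor (a *: repr x).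

Lemma pi_tensorZ a x : tensor_scale a (\pi x) = \pi_tensor (a *: x).
Proof.
apply/tensor_eqP; rewrite -scalerBr -[a *: _]addr0; apply: bilin_relP.
  by apply/tensor_eqP; rewrite reprK.
exact: bilin_rel0.
Qed.

Let pi_tensorD (x y : {freeg (V * W)%type / k}) :
  \pi_tensor (x + y) = \pi_tensor x + \pi_tensor y.
Proof. exact: pi_addr. Qed.

Lemma tensor_scaleA a b v :
  tensor_scale a (tensor_scale b v) = tensor_scale (a * b) v.
Proof. by elim/quotW: v => v; rewrite !pi_tensorZ scalerA. Qed.

Lemma tensor_scale1 : left_id 1 tensor_scale.
Proof. by elim/quotW => v; rewrite !pi_tensorZ scale1r. Qed.

Lemma tensor_scaleDr : right_distributive tensor_scale +%R.
Proof.
move=> a; elim/quotW => u; elim/quotW => v.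
by rewrite -pi_tensorD !pi_tensorZ scalerDr pi_tensorD.
Qed.

Lemma tensor_scaleDl v : {morph tensor_scale^~ v : a b / a + b}.
Proof.
move=> a b; elim/quotW: v => v.
by rewrite !pi_tensorZ scalerDl pi_tensorD.
Qed.

HB.instance Definition _ := GRing.Zmodule_isLmodule.Build k tensor
  tensor_scaleA tensor_scale1 tensor_scaleDr tensor_scaleDl.

Definition tens (v : V) (w : W) : tensor := \pi_tensor (fpair v w).

Lemma tens_bilinear : bilinear_for *:%R *:%R tens.
Proof.
have E a x y : a *: \pi_tensor x + \pi_tensor y = \pi_tensor (a *: x + y).
  by rewrite pi_tensorD -pi_tensorZ.
by split=> u a x y; rewrite /= /applyr E; apply/tensor_eqP; constructor.
Qed.
HB.instance Definition _ :=
  bilinear_isBilinear.Build k V W tensor *:%R *:%R tens tens_bilinear.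
HB.instance Definition _ v :=
  GRing.isLinear.Build k W tensor *:%R (tens v) (tens_bilinear.2 v).

Lemma tens_ext (U : lmodType k) (f g : {linear tensor -> U}) :
  (forall v w, f (tens v w) = g (tens v w)) -> f =1 g.
Proof.
move=> fg; elim/quotW => x; rewrite -[x]freeg_sumE.
elim/big_ind: _ => [|x1 x2 h1 h2|[v w] _].
- by rewrite [\pi 0](@pi_zeror _ _ _ _ _ tensor) !linear0.
- by rewrite pi_tensorD !linearD h1 h2.
have -> : << coeff (v, w) x *g (v, w) >> = coeff (v, w) x *: fpair v w.
  by apply/eqP/freeg_eqP => z; rewrite coeffZ !coeffU mul1r.
by rewrite -pi_tensorZ !linearZ -/(tens v w) /= fg.
Qed.

(* The universal property. *)
Section Lift.
Variables (U : lmodType k) (b : {bilinear V -> W -> U}).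

Let flift (x : {freeg (V * W)%type / k}) : U := fglift (fun p => b p.1 p.2) x.

Let fliftB x y : flift (x - y) = flift x - flift y.
Proof. exact: lift_is_additive. Qed.

Let flift0 : flift 0 = 0.
Proof. by rewrite -(subrr 0) fliftB subrr. Qed.

Let fliftD x y : flift (x + y) = flift x + flift y.
Proof. by rewrite -{1}[y]opprK -(sub0r y) fliftB fliftB flift0 sub0r opprK. Qed.

Let fliftZ a x : flift (a *: x) = a *: flift x.
Proof.
rewrite -{2}[x]freeg_sumE -[a *: x]/(fgscale a x) /fgscale.
elim/big_rec2: _ => [|p y z _ IH]; first by rewrite flift0 scaler0.
by rewrite !fliftD IH /flift !liftU scalerDr scalerA.
Qed.

Let fliftE v w : flift (fpair v w) = b v w.
Proof. by rewrite /flift liftU scale1r. Qed.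

Let flift_rel x : bilin_rel x -> flift x = 0.
Proof.
elim=> [|a y z _ y0 _ z0|a v v' w|a v w w'].
- exact: flift0.
- by rewrite fliftD fliftZ y0 z0 scaler0 addr0.
- by rewrite fliftB fliftD fliftZ !fliftE linearPl subrr.
by rewrite fliftB fliftD fliftZ !fliftE linearPr subrr.
Qed.

Definition tlift_fun (x : tensor) : U :=
  fglift (fun p => b p.1 p.2) (repr x : {freeg (V * W)%type / k}).

Let tlift_pi x : tlift_fun (\pi x) = flift x.
Proof.
apply/eqP; rewrite -subr_eq0 -fliftB; apply/eqP/flift_rel.
by apply/tensor_eqP; rewrite reprK.
Qed.

Lemma tlift_linear : linear tlift_fun.
Proof.
move=> a; elim/quotW => x; elim/quotW => y.
by rewrite [_ *: _]pi_tensorZ -pi_tensorD !tlift_pi fliftD fliftZ.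
Qed.

Lemma tlift_funE v w : tlift_fun (tens v w) = b v w.
Proof. by rewrite tlift_pi fliftE. Qed.

End Lift.
End Tensor.

HB.lock Definition tlift (k : fieldType) (V W U : lmodType k)
  (b : {bilinear V -> W -> U}) : {linear tensor V W -> U} :=
  mklin (tlift_linear b).

Lemma tliftE (k : fieldType) (V W U : lmodType k)
  (b : {bilinear V -> W -> U}) v w : tlift b (tens v w) = b v w.
Proof. by rewrite tlift.unlock; exact: tlift_funE. Qed.

(* [tensor V W] with its [lmodType] structure. *)
Notation "V ⊗ W" := (Defs_tensor__canonical__GRing_Lmodule V W)
  (at level 40, left associativity).


Section Tmap.
Variables (k : fieldType) (V V' W W' : lmodType k).
Variables (f : {linear V -> V'}) (g : {linear W -> W'}).

Lemma tmap_bilinear :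
  bilinear_for *:%R *:%R (fun v w => tens (f v) (g w) : V' ⊗ W').
Proof. by split=> u a x y; rewrite /= /applyr linearP (linearPl, linearPr). Qed.

End Tmap.

HB.lock Definition tmap (k : fieldType) (V V' W W' : lmodType k)
  (f : {linear V -> V'}) (g : {linear W -> W'}) : {linear V ⊗ W -> V' ⊗ W'} :=
  tlift (mkbilin (tmap_bilinear f g)).

Section TmapTheory.
Context {k : fieldType}.
Implicit Types V W : lmodType k.

Lemma tmapE V V' W W' (f : {linear V -> V'}) (g : {linear W -> W'}) v w :
  tmap f g (tens v w) = tens (f v) (g w).
Proof. by rewrite tmap.unlock; exact: tliftE. Qed.

Lemma tmap_ext V V' W W' (f f' : {linear V -> V'}) (g g' : {linear W -> W'}) :
  f =1 f' -> g =1 g' -> tmap f g =1 tmap f' g'.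
Proof. by move=> /lin_eq -> /lin_eq ->. Qed.

Lemma tmap_idE V W : tmap idfun idfun = idfun :> {linear V ⊗ W -> V ⊗ W}.
Proof. by apply/lin_eq/tens_ext => v w; exact: tmapE. Qed.

Lemma tmap_id V W (x : V ⊗ W) : tmap idfun idfun x = x.
Proof. by rewrite tmap_idE. Qed.

Lemma tmap_comp V V' V'' W W' W''
    (f : {linear V -> V'}) (f' : {linear V' -> V''})
    (g : {linear W -> W'}) (g' : {linear W' -> W''}) x :
  tmap f' g' (tmap f g x) = tmap (f' \o f) (g' \o g) x.
Proof.
move: x; apply: (tens_ext (f := tmap f' g' \o tmap f g)) => v w.
by rewrite /= !tmapE.
Qed.

Lemma tmap_compl V V' V'' W
    (f : {linear V -> V'}) (f' : {linear V' -> V''}) x :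
  tmap f' idfun (tmap f (idfun : {linear W -> W}) x) = tmap (f' \o f) idfun x.
Proof. by rewrite tmap_comp; exact: tmap_ext. Qed.

Lemma tmap_compr V W W' W''
    (g : {linear W -> W'}) (g' : {linear W' -> W''}) x :
  tmap idfun g' (tmap (idfun : {linear V -> V}) g x) = tmap idfun (g' \o g) x.
Proof. by rewrite tmap_comp; exact: tmap_ext. Qed.

Lemma tmap_lr V V' W W' (f : {linear V -> V'}) (g : {linear W -> W'}) x :
  tmap f idfun (tmap idfun g x) = tmap f g x.
Proof. by rewrite tmap_comp; exact: tmap_ext. Qed.

Lemma tmap_rl V V' W W' (f : {linear V -> V'}) (g : {linear W -> W'}) x :
  tmap idfun g (tmap f idfun x) = tmap f g x.
Proof. by rewrite tmap_comp; exact: tmap_ext. Qed.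

End TmapTheory.

Section Assoc.
Variables (k : fieldType) (U V W : lmodType k).

Lemma tassoc_bilinear : bilinear_for *:%R *:%R
  (fun (t : U ⊗ V) (w : W) => tmap idfun (applyr (@tens k V W) w) t : U ⊗ (V ⊗ W)).
Proof.
split=> u a x y; rewrite /= /applyr ?linearP //.
pose f1 := tmap (idfun : {linear U -> U}) (applyr (@tens k V W) x) : {linear U ⊗ V -> _}.
pose f2 := tmap (idfun : {linear U -> U}) (applyr (@tens k V W) y) : {linear U ⊗ V -> _}.
rewrite -[RHS]/((a \*: f1 \+ f2) u); move: u; apply: tens_ext => v w.
by rewrite /= /f1 /f2 !tmapE /= /applyr linearPr linearPr.
Qed.

Lemma tassocV_bilinear : bilinear_for *:%R *:%R
  (fun (u : U) (t : V ⊗ W) => tmap (@tens k U V u) idfun t : (U ⊗ V) ⊗ W).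
Proof.
split=> u a x y; rewrite /= /applyr ?linearP //.
pose f1 := tmap (@tens k U V x) (idfun : {linear W -> W}) : {linear V ⊗ W -> _}.
pose f2 := tmap (@tens k U V y) (idfun : {linear W -> W}) : {linear V ⊗ W -> _}.
rewrite -[RHS]/((a \*: f1 \+ f2) u); move: u; apply: tens_ext => v w.
by rewrite /= /f1 /f2 !tmapE /= !linearPl.
Qed.

End Assoc.

HB.lock Definition tassoc {k : fieldType} {U V W : lmodType k} :
  {linear (U ⊗ V) ⊗ W -> U ⊗ (V ⊗ W)} := tlift (mkbilin (tassoc_bilinear U V W)).

HB.lock Definition tassocV {k : fieldType} {U V W : lmodType k} :
  {linear U ⊗ (V ⊗ W) -> (U ⊗ V) ⊗ W} := tlift (mkbilin (tassocV_bilinear U V W)).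

Section AssocTheory.
Context {k : fieldType}.
Implicit Types U V W X : lmodType k.

Lemma tassocE U V W (u : U) (v : V) (w : W) :
  tassoc (tens (tens u v) w) = tens u (tens v w).
Proof. by rewrite tassoc.unlock tliftE /= tmapE. Qed.

Lemma tassocVE U V W (u : U) (v : V) (w : W) :
  tassocV (tens u (tens v w)) = tens (tens u v) w.
Proof. by rewrite tassocV.unlock tliftE /= tmapE. Qed.

Lemma tens_ext3l U V W X (f g : {linear (U ⊗ V) ⊗ W -> X}) :
  (forall u v w, f (tens (tens u v) w) = g (tens (tens u v) w)) -> f =1 g.
Proof.
move=> fg; apply: tens_ext => t w; move: t.
apply: (tens_ext (f := f \o applyr (@tens k (U ⊗ V) W) w)
  (g := g \o applyr (@tens k (U ⊗ V) W) w)) => u v.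
exact: fg.
Qed.

Lemma tens_ext3r U V W X (f g : {linear U ⊗ (V ⊗ W) -> X}) :
  (forall u v w, f (tens u (tens v w)) = g (tens u (tens v w))) -> f =1 g.
Proof.
move=> fg; apply: tens_ext => u.
apply: (tens_ext (f := f \o @tens k U (V ⊗ W) u)
  (g := g \o @tens k U (V ⊗ W) u)) => v w.
exact: fg.
Qed.

Lemma tassocK U V W (x : (U ⊗ V) ⊗ W) : tassocV (tassoc x) = x.
Proof.
move: x; apply: (tens_ext3l (f := @tassocV k U V W \o @tassoc k U V W)
  (g := idfun)) => u v w.
by rewrite /= tassocE tassocVE.
Qed.

Lemma tassocVK U V W (x : U ⊗ (V ⊗ W)) : tassoc (tassocV x) = x.
Proof.
move: x; apply: (tens_ext3r (f := @tassoc k U V W \o @tassocV k U V W)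
  (g := idfun)) => u v w.
by rewrite /= tassocVE tassocE.
Qed.

Lemma tassoc_nat U V W U' V' W' (f : {linear U -> U'}) (g : {linear V -> V'})
    (h : {linear W -> W'}) x :
  tassoc (tmap (tmap f g) h x) = tmap f (tmap g h) (tassoc x).
Proof.
move: x; apply: (tens_ext3l (f := @tassoc k _ _ _ \o tmap (tmap f g) h)
  (g := tmap f (tmap g h) \o @tassoc k _ _ _)) => u v w.
by rewrite /= !(tmapE, tassocE).
Qed.

Lemma tassoc_natl U V W U' (f : {linear U -> U'}) (x : (U ⊗ V) ⊗ W) :
  tassoc (tmap (tmap f idfun) idfun x) = tmap f idfun (tassoc x).
Proof. by rewrite tassoc_nat tmap_idE. Qed.

Lemma tassoc_natm U V W V' (g : {linear V -> V'}) (x : (U ⊗ V) ⊗ W) :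
  tassoc (tmap (tmap idfun g) idfun x) = tmap idfun (tmap g idfun) (tassoc x).
Proof. exact: tassoc_nat. Qed.

Lemma tassoc_natr U V W W' (h : {linear W -> W'}) (x : (U ⊗ V) ⊗ W) :
  tassoc (tmap idfun h x) = tmap idfun (tmap idfun h) (tassoc x).
Proof. by rewrite -tassoc_nat tmap_idE. Qed.

Lemma tassoc_pentagon U V W X (x : ((U ⊗ V) ⊗ W) ⊗ X) :
  tassoc (tassoc x) =
  tmap idfun (@tassoc k V W X) (tassoc (tmap (@tassoc k U V W) idfun x)).
Proof.
move: x; apply: (tens_ext (f := @tassoc k U V (W ⊗ X) \o @tassoc k (U ⊗ V) W X)
 (g := tmap idfun (@tassoc k V W X) \o (@tassoc k U (V ⊗ W) X \o
       tmap (@tassoc k U V W) idfun))) => t x; move: t.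
pose F := @tassoc k U V (W ⊗ X) \o @tassoc k (U ⊗ V) W X.
pose G := tmap idfun (@tassoc k V W X) \o (@tassoc k U (V ⊗ W) X \o
       tmap (@tassoc k U V W) idfun).
apply: (tens_ext3l (f := F \o applyr (@tens k ((U ⊗ V) ⊗ W) X) x)
  (g := G \o applyr (@tens k ((U ⊗ V) ⊗ W) X) x)).
by move=> u v w; rewrite /F /G /= /applyr !(tmapE, tassocE).
Qed.

End AssocTheory.

Section Unit.
Variables (k : fieldType) (V : lmodType k).

Lemma runit_bilinear : bilinear_for *:%R *:%R (fun (v : V) (a : k^o) => a *: v).
Proof.
split=> u a x y; first by rewrite /= /applyr scalerDr !scalerA mulrC.
by rewrite /= scalerDl scalerA.
Qed.

Lemma lunit_bilinear : bilinear_for *:%R *:%R (fun (a : k^o) (v : V) => a *: v).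
Proof.
split=> u a x y; last by rewrite /= scalerDr !scalerA mulrC.
by rewrite /= /applyr scalerDl scalerA.
Qed.

End Unit.

HB.lock Definition runit {k : fieldType} {V : lmodType k} :
  {linear V ⊗ k^o -> V} := tlift (mkbilin (runit_bilinear V)).

HB.lock Definition lunit {k : fieldType} {V : lmodType k} :
  {linear k^o ⊗ V -> V} := tlift (mkbilin (lunit_bilinear V)).

Section UnitTheory.
Context {k : fieldType}.
Implicit Types V W : lmodType k.

Lemma runitE V (v : V) (a : k^o) : runit (tens v a) = a *: v.
Proof. by rewrite runit.unlock; exact: tliftE. Qed.

Lemma lunitE V (v : V) (a : k^o) : lunit (tens a v) = a *: v.
Proof. by rewrite lunit.unlock; exact: tliftE. Qed.

Lemma runit_nat V W (f : {linear V -> W}) x :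
  runit (tmap f idfun x) = f (runit x).
Proof.
move: x; apply: (tens_ext (f := @runit k W \o tmap f idfun)
  (g := f \o @runit k V)) => v a.
by rewrite /= tmapE !runitE linearZ.
Qed.

Lemma lunit_nat V W (f : {linear V -> W}) x :
  lunit (tmap idfun f x) = f (lunit x).
Proof.
move: x; apply: (tens_ext (f := @lunit k W \o tmap idfun f)
  (g := f \o @lunit k V)) => v a.
by rewrite /= tmapE !lunitE linearZ.
Qed.

Lemma lunit_assoc V W (x : (k^o ⊗ V) ⊗ W) :
  lunit (tassoc x) = tmap (@lunit k V) idfun x.
Proof.
move: x; apply: (tens_ext3l (f := @lunit k _ \o @tassoc k k^o V W)) => a v w.
by rewrite /= tassocE tmapE !lunitE linearZl.
Qed.

Lemma runit_assoc V W (x : (V ⊗ W) ⊗ k^o) :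
  tmap idfun (@runit k W) (tassoc x) = runit x.
Proof.
move: x; apply: (tens_ext3l (f := tmap idfun (@runit k W) \o @tassoc k V W k^o)).
by move=> v w a; rewrite /= tassocE tmapE !runitE linearZr.
Qed.

End UnitTheory.


Section Kernel.
Context {k : fieldType}.
Variables (V W : lmodType k) (f : {linear V -> W}).

Definition kerp : {pred V} := fun x => f x == 0.

Lemma kerp_submod : submod_closed kerp.
Proof.
split; first by rewrite unfold_in /kerp linear0.
by move=> a x y; rewrite !unfold_in /kerp linearP => /eqP -> /eqP ->;
  rewrite scaler0 addr0.
Qed.
HB.instance Definition _ := GRing.isSubmodClosed.Build k V kerp kerp_submod.

Record ker : Type := Ker { ker_val : V; _ : ker_val \in kerp }.
HB.instance Definition _ := [isSub for ker_val].
HB.instance Definition _ := [Choice of ker by <:].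
HB.instance Definition _ := [SubChoice_isSubLmodule of ker by <:].

Lemma ker_valP (x : ker) : f (ker_val x) = 0.
Proof. by case: x => x /= /eqP. Qed.

Lemma ker_val_linear : linear ker_val.
Proof. by move=> a x y; exact: (linearP (val : ker -> V)). Qed.
HB.instance Definition _ :=
  GRing.isLinear.Build k ker V *:%R ker_val ker_val_linear.

Lemma ker_corestr (U : lmodType k) (g : {linear U -> V}) :
  (forall x, f (g x) = 0) ->
  {h : {linear U -> ker} | forall x, ker_val (h x) = g x}.
Proof.
move=> fg; have gk x : g x \in kerp by rewrite unfold_in /kerp fg.
have lh : linear (fun x => Ker (gk x)).
  by move=> a x y; apply: val_inj; rewrite /= linearP.
by exists (mklin lh).
Qed.

End Kernel.

(* Exactness of [- ⊗ C] over a field: it preserves kernels. *)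
Section Flat.
Context {k : fieldType}.

Lemma complement_ex (V : lmodType k) (K : {pred V}) : submod_closed K ->
  exists p : {linear V -> V},
    (forall x, p x \in K) /\ (forall x, x \in K -> p x = x).
Proof.
move=> Ksub.
have K0 : 0 \in K by case: Ksub.
have KD a x y : x \in K -> y \in K -> a *: x + y \in K by case: Ksub => _; apply.
have KZ a x : x \in K -> a *: x \in K.
  by move=> xK; rewrite -[_ *: _]addr0; exact: KD.
have KB x y : x \in K -> y \in K -> x - y \in K.
  by move=> xK yK; rewrite addrC -scaleN1r; exact: KD.
pose P (A : set V) := (forall a x y, A x -> A y -> A (a *: x + y)) /\
  (forall x, A x -> x \in K -> x = 0).
have [F FP Ftot|A [[Alin AK] Amax]] := @Zorn_bigcup V P.
  split=> [a x y [X FX Xx] [Y FY Yy]|x [X FX Xx]]; last exact: (FP _ FX).2.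
  have [XY|YX] := Ftot _ _ FX FY.
    by exists Y => //; apply: (FP _ FY).1 => //; exact: XY.
  by exists X => //; apply: (FP _ FX).1 => //; exact: YX.
pose M x := x = 0 \/ A x.
have MD a x y : M x -> M y -> M (a *: x + y).
  move=> [->|Ax] [->|Ay]; rewrite ?(scaler0, addr0, add0r); rewrite /M; auto.
  by right; rewrite -[a *: x](subrK x) -{2}[x]scale1r -scalerBl; exact: Alin.
have MZ a x : M x -> M (a *: x).
  by move=> Mx; rewrite -[_ *: _]addr0; apply: MD => //; left.
have MB x y : M x -> M y -> M (x - y).
  by move=> xK yK; rewrite addrC -scaleN1r; exact: MD.
have MK x : M x -> x \in K -> x = 0 by case=> // Ax; exact: AK.
have dec v : exists2 m, M m & v - m \in K.
  apply: contrapT => nv.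
  pose B x := exists a y, M y /\ x = a *: v + y.
  apply: (Amax B).
    split=> [x Ax|]; first by exists 0, x; rewrite scale0r add0r; split=> //; right.
    move=> /(_ v) BA; apply: nv; exists v; last by rewrite subrr.
    by right; apply: BA; exists 1, 0; rewrite scale1r addr0; split=> //; left.
  split=> [a x y [b [x' [Mx' ->]]] [c [y' [My' ->]]]|x [a [y [My ->]]]].
    exists (a * b + c), (a *: x' + y'); split; first exact: MD.
    by rewrite scalerDr scalerA scalerDl addrACA.
  have [->|a0] := eqVneq a 0; first by rewrite scale0r add0r => /(MK _ My).
  move=> vK; exfalso; apply: nv; exists (- a^-1 *: y); first exact: MZ.
  have := KZ a^-1 _ vK; rewrite scalerDr scalerA mulVf // scale1r.
  by rewrite scaleNr opprK.
pose m v := s2val (cid2 (dec v)).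
have Mm v : M (m v) by rewrite /m; case: cid2.
have mK v : v - m v \in K by rewrite /m; case: cid2.
have muniq v x : M x -> v - x \in K -> x = m v.
  move=> Mx vx; apply/eqP; rewrite -subr_eq0; apply/eqP/MK; first exact: MB.
  by have := KB _ _ (mK v) vx; rewrite opprB addrAC addrCA subrr addr0 addrC.
have lm : linear (fun v => v - m v).
  move=> a x y; suff <- : a *: m x + m y = m (a *: x + y).
    by rewrite scalerBr opprD addrACA.
  apply: muniq; first exact: MD.
  by rewrite opprD addrACA -scalerBr; exact: KD.
exists (mklin lm); split=> // x xK /=.
by rewrite -(muniq x 0) ?subr0 //; left.
Qed.

Lemma geninv_ex (V W : lmodType k) (f : {linear V -> W}) :
  exists g : {linear W -> V}, forall x, f (g (f x)) = f x.
Proof.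
have [p [pK pE]] := complement_ex (kerp_submod f).
pose I : {pred W} := fun w => `[< exists v, f v = w >].
have Isub : submod_closed I.
  split; first by apply/asboolP; exists 0; rewrite linear0.
  move=> a x y /asboolP[u <-] /asboolP[v <-]; apply/asboolP.
  by exists (a *: u + v); rewrite linearP.
have [e [eI eE]] := complement_ex Isub.
have ex w : exists v, f v = e w by apply/asboolP; exact: eI.
pose s w := sval (cid (ex w)).
have sE w : f (s w) = e w by rewrite /s; case: cid.
pose q v := v - p v.
have qf u v : f u = f v -> q u = q v.
  move=> fuv; have uv : u - v \in kerp f by rewrite unfold_in /kerp linearB fuv subrr.
  have := pE _ uv; rewrite linearB => /= E.
  apply/eqP; rewrite -subr_eq0 /q opprD opprK addrACA -E addrACA subrr addNr.
  by rewrite addr0.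
have qD a u v : q (a *: u + v) = a *: q u + q v.
  by rewrite /q linearP opprD addrACA scalerBr.
have fq v : f (q v) = f v.
  by rewrite /q linearB (eqP (pK v : f (p v) == 0)) subr0.
have lg : linear (fun w => q (s w)).
  by move=> a x y; rewrite -qD; apply: qf; rewrite linearP !sE linearP.
exists (mklin lg) => x /=; rewrite fq sE eE //.
by apply/asboolP; exists x.
Qed.

Variables (V W : lmodType k) (f : {linear V -> W}) (C : lmodType k).
Let kv : {linear ker f -> V} := @ker_val k V W f.

Let ker_retr : exists2 r : {linear V -> ker f}, cancel kv r &
  forall x : V ⊗ C, tmap f idfun x = 0 -> tmap kv idfun (tmap r idfun x) = x.
Proof.
have [g gE] := geninv_ex f.
have [|r rE] := @ker_corestr k V W f V (idfun \- (g \o f)).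
  by move=> x; rewrite /= linearB gE subrr.
exists r => [x|x fx0].
  by apply: val_inj; rewrite /= rE /= ker_valP linear0 subr0.
have : tmap (g \o f) (idfun : {linear C -> C}) x = 0.
  by rewrite -tmap_compl fx0 linear0.
move=> E; rewrite tmap_compl.
rewrite -[RHS]subr0 -E -[RHS]/((idfun \- tmap (g \o f) idfun) x).
move: x {fx0 E}; apply: tens_ext => v c.
by rewrite /= !tmapE /= rE linearBl.
Qed.

Lemma tmap_ker_inj : injective (tmap kv (idfun : {linear C -> C})).
Proof.
have [r kvK _] := ker_retr; apply: (can_inj (g := tmap r idfun)) => x.
rewrite tmap_comp -[RHS]tmap_id; apply: tmap_ext => // y; exact: kvK.
Qed.

Lemma tmap_ker_corestr (U : lmodType k) (h : {linear U -> V ⊗ C}) :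
  (forall x, tmap f idfun (h x) = 0) ->
  {h' : {linear U -> ker f ⊗ C} | forall x, tmap kv idfun (h' x) = h x}.
Proof.
move=> fh; apply: cid; have [r _ rE] := ker_retr.
by exists (tmap r idfun \o h) => x; exact: rE.
Qed.

End Flat.

(* Coalgebras and comodules are coassociative and counital. *)
Section Coalgebra.
Variable k : fieldType.

Record coalgebra : Type := Coalgebra {
  coalg_mod :> lmodType k;
  comul : {linear coalg_mod -> coalg_mod ⊗ coalg_mod};
  counit : {linear coalg_mod -> k^o};
  comulA : forall c, tassoc (tmap comul idfun (comul c)) =
                     tmap idfun comul (comul c);
  counitl : forall c, lunit (tmap counit idfun (comul c)) = c;
  counitr : forall c, runit (tmap idfun counit (comul c)) = c
}.

Record coalg_hom (C D : coalgebra) : Type := CoalgHom {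
  coalg_fun :> {linear C -> D};
  coalg_funM : forall c,
    comul D (coalg_fun c) = tmap coalg_fun coalg_fun (comul C c);
  coalg_fun1 : forall c, counit D (coalg_fun c) = counit C c
}.

Definition right_coaction (C : coalgebra) (M : lmodType k)
    (rho : {linear M -> M ⊗ C}) : Prop :=
  (forall m, tassoc (tmap rho idfun (rho m)) = tmap idfun (comul C) (rho m)) /\
  (forall m, runit (tmap idfun (counit C) (rho m)) = m).

Definition left_coaction (C : coalgebra) (M : lmodType k)
    (lambda : {linear M -> C ⊗ M}) : Prop :=
  (forall m, tassoc (tmap (comul C) idfun (lambda m)) =
             tmap idfun lambda (lambda m)) /\
  (forall m, lunit (tmap (counit C) idfun (lambda m)) = m).

Record rcomod (C : coalgebra) : Type := RComod {
  rcomod_mod :> lmodType k;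
  rho : {linear rcomod_mod -> rcomod_mod ⊗ C};
  rhoP : right_coaction rho
}.

Record bicomod (C D : coalgebra) : Type := Bicomod {
  bicomod_mod :> lmodType k;
  lcoact : {linear bicomod_mod -> C ⊗ bicomod_mod};
  rcoact : {linear bicomod_mod -> bicomod_mod ⊗ D};
  lcoactP : left_coaction lcoact;
  rcoactP : right_coaction rcoact;
  bicomodP : forall m, tassoc (tmap lcoact idfun (rcoact m)) =
                       tmap idfun rcoact (lcoact m)
}.

Record rcomod_hom (C : coalgebra) (M N : rcomod C) : Type := RComodHom {
  rcomod_fun :> {linear M -> N};
  rcomod_funP : forall m, rho N (rcomod_fun m) = tmap rcomod_fun idfun (rho M m)
}.

Record bicomod_hom (C D : coalgebra) (M N : bicomod C D) : Type := BicomodHom {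
  bicomod_fun :> {linear M -> N};
  bicomod_funl : forall m,
    lcoact N (bicomod_fun m) = tmap idfun bicomod_fun (lcoact M m);
  bicomod_funr : forall m,
    rcoact N (bicomod_fun m) = tmap bicomod_fun idfun (rcoact M m)
}.

Lemma rcomod_hom_eq C (M N : rcomod C) (f g : rcomod_hom M N) :
  f =1 g -> f = g.
Proof.
case: f g => f fP [g gP] /= /lin_eq fg; subst g.
by congr RComodHom; exact: Prop_irrelevance.
Qed.

Lemma bicomod_hom_eq C D (M N : bicomod C D) (f g : bicomod_hom M N) :
  f =1 g -> f = g.
Proof.
case: f g => f fl fr [g gl gr] /= /lin_eq fg; subst g.
by congr BicomodHom; exact: Prop_irrelevance.
Qed.

Lemma rcomod_idP C (M : rcomod C) m : rho M (idfun m) = tmap idfun idfun (rho M m).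
Proof. by rewrite tmap_id. Qed.
Definition rcomod_id C (M : rcomod C) : rcomod_hom M M :=
  RComodHom (@rcomod_idP C M).

Lemma rcomod_compP C (M N P : rcomod C) (g : rcomod_hom N P)
  (f : rcomod_hom M N) m : rho P ((g \o f) m) = tmap (g \o f) idfun (rho M m).
Proof. by rewrite /= !rcomod_funP tmap_compl. Qed.
Definition rcomod_comp C (M N P : rcomod C) (g : rcomod_hom N P)
  (f : rcomod_hom M N) : rcomod_hom M P := RComodHom (rcomod_compP g f).

Lemma bicomod_idl C D (M : bicomod C D) m :
  lcoact M (idfun m) = tmap idfun idfun (lcoact M m).
Proof. by rewrite tmap_id. Qed.
Lemma bicomod_idr C D (M : bicomod C D) m :
  rcoact M (idfun m) = tmap idfun idfun (rcoact M m).
Proof. by rewrite tmap_id. Qed.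
Definition bicomod_id C D (M : bicomod C D) : bicomod_hom M M :=
  BicomodHom (@bicomod_idl C D M) (@bicomod_idr C D M).

Section BicomodComp.
Variables (C D : coalgebra) (M N P : bicomod C D).
Variables (g : bicomod_hom N P) (f : bicomod_hom M N).
Lemma bicomod_compl m :
  lcoact P ((g \o f) m) = tmap idfun (g \o f) (lcoact M m).
Proof. by rewrite /= !bicomod_funl tmap_compr. Qed.
Lemma bicomod_compr m :
  rcoact P ((g \o f) m) = tmap (g \o f) idfun (rcoact M m).
Proof. by rewrite /= !bicomod_funr tmap_compl. Qed.
Definition bicomod_comp : bicomod_hom M P := BicomodHom bicomod_compl bicomod_compr.
End BicomodComp.

End Coalgebra.

Record category : Type := Category {
  obj :> Type;
  hom : obj -> obj -> Type;
  idm : forall X, hom X X;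
  comp : forall X Y Z, hom Y Z -> hom X Y -> hom X Z;
  compA : forall W X Y Z (h : hom Y Z) (g : hom X Y) (f : hom W X),
    comp h (comp g f) = comp (comp h g) f;
  comp1m : forall X Y (f : hom X Y), comp (idm Y) f = f;
  compm1 : forall X Y (f : hom X Y), comp f (idm X) = f
}.
Arguments hom {c} X Y.
Arguments idm {c} X.
Arguments comp {c X Y Z} g f.

Record functor (A B : category) : Type := Functor {
  fobj :> A -> B;
  fmap : forall X Y, hom X Y -> hom (fobj X) (fobj Y);
  fmap1 : forall X, fmap (idm X) = idm (fobj X);
  fmapM : forall X Y Z (g : hom Y Z) (f : hom X Y),
    fmap (comp g f) = comp (fmap g) (fmap f)
}.
Arguments fmap {A B} F {X Y} f : rename.

Definition regular (A : category) (X Y : A) (f : hom X Y) : Prop :=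
  exists g : hom Y X, comp f (comp g f) = f.

(* Naturality of a family [P : Hom(F -, F -) -> Hom(-, -)], contravariant in
   the first variable and covariant in the second. *)
Definition hom_natural (A B : category) (F : functor A B)
    (P : forall X Y : A, hom (F X) (F Y) -> hom X Y) : Prop :=
  forall (X X' Y Y' : A) (f : hom X' X) (g : hom Y Y') (h : hom (F X) (F Y)),
    P X' Y' (comp (fmap F g) (comp h (fmap F f))) = comp g (comp (P X Y h) f).

Definition semiseparable (A B : category) (F : functor A B) : Prop :=
  exists2 P : (forall X Y : A, hom (F X) (F Y) -> hom X Y), hom_natural P &
    forall (X Y : A) (f : hom X Y), fmap F (P X Y (fmap F f)) = fmap F f.

Section Cotensor.
Variable k : fieldType.

Definition rcomod_cat (C : coalgebra k) : category.
Proof.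
refine (@Category (rcomod C) (@rcomod_hom k C) (@rcomod_id k C)
  (@rcomod_comp k C) _ _ _) => *; exact: rcomod_hom_eq.
Defined.

Definition bicomod_cat (C D : coalgebra k) : category.
Proof.
refine (@Category (bicomod C D) (@bicomod_hom k C D) (@bicomod_id k C D)
  (@bicomod_comp k C D) _ _ _) => *; exact: bicomod_hom_eq.
Defined.

Section CotensorObj.
Variables (D E : coalgebra k) (N : rcomod D) (L : bicomod D E).

Definition cotens_map : {linear N ⊗ L -> N ⊗ (D ⊗ L)} :=
  (tassoc \o tmap (rho N) idfun) \- tmap idfun (lcoact L).

Definition cotens : lmodType k := ker cotens_map.

End CotensorObj.
End Cotensor.

HB.lock Definition cotens_val (k : fieldType) (D E : coalgebra k) (N : rcomod D)
  (L : bicomod D E) : {linear cotens N L -> N ⊗ L} :=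
  @ker_val k _ _ (cotens_map N L).

Section CotensorTheory.
Variable k : fieldType.

Section CotensorRho.
Variables (D E : coalgebra k) (N : rcomod D) (L : bicomod D E).
Local Notation cotens_map := (cotens_map N L).
Local Notation cotens := (cotens N L).
Local Notation cotens_val := (cotens_val N L).

Lemma cotens_mapE x :
  cotens_map x = tassoc (tmap (rho N) idfun x) - tmap idfun (lcoact L) x.
Proof. by []. Qed.

Lemma cotens_valP x :
  tassoc (tmap (rho N) idfun (cotens_val x)) = tmap idfun (lcoact L) (cotens_val x).
Proof.
rewrite cotens_val.unlock; apply/eqP; rewrite -subr_eq0; apply/eqP.
exact: (@ker_valP k _ _ cotens_map x).
Qed.

Lemma cotens_val_inj : injective cotens_val.
Proof. by rewrite cotens_val.unlock; exact: val_inj. Qed.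

Lemma cotens_corestr (V : lmodType k) (g : {linear V -> N ⊗ L}) :
  (forall x, cotens_map (g x) = 0) ->
  {h : {linear V -> cotens} | forall x, cotens_val (h x) = g x}.
Proof. by rewrite cotens_val.unlock; exact: ker_corestr. Qed.

Lemma tmap_cotens_val_inj (V : lmodType k) :
  injective (tmap cotens_val (idfun : {linear V -> V})).
Proof. by rewrite cotens_val.unlock; exact: tmap_ker_inj. Qed.

Lemma tmap_cotens_corestr (V W : lmodType k) (g : {linear V -> (N ⊗ L) ⊗ W}) :
  (forall x, tmap cotens_map idfun (g x) = 0) ->
  {h : {linear V -> cotens ⊗ W} |
    forall x, tmap cotens_val idfun (h x) = g x}.
Proof. by rewrite cotens_val.unlock; exact: tmap_ker_corestr. Qed.

Lemma cotens_rho_subproof x :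
  tmap cotens_map idfun (tassocV (tmap idfun (rcoact L) (cotens_val x))) = 0.
Proof.
set y := tassocV _.
have yE : tassoc y = tmap idfun (rcoact L) (cotens_val x) by rewrite tassocVK.
have -> : tmap cotens_map idfun y =
    tmap (tassoc \o tmap (rho N) idfun) idfun y -
    tmap (tmap idfun (lcoact L)) idfun y.
  rewrite -[RHS]/((tmap (tassoc \o tmap (rho N) idfun) idfun \-
    tmap (tmap idfun (lcoact L)) idfun) y).
  move: (y); apply: tens_ext => t e; rewrite /= !tmapE.
  by rewrite -linearBl.
apply/eqP; rewrite subr_eq0; apply/eqP.
have assoc_inj : injective (tmap (idfun : {linear N -> N}) (@tassoc k D L E)).
  apply: (can_inj (g := tmap idfun tassocV)) => z.
  rewrite tmap_compr -[RHS]tmap_id; apply: tmap_ext => // t; exact: tassocK.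
apply/(can_inj (@tassocK _ _ _ _))/assoc_inj.
rewrite -tmap_compl -tassoc_pentagon tassoc_natl tassoc_natm yE.
rewrite tmap_lr -tmap_rl tassoc_natr cotens_valP !tmap_compr.
by apply: tmap_ext => // l; rewrite /= bicomodP.
Qed.

Definition cotens_rho : {linear cotens -> cotens ⊗ E} :=
  sval (tmap_cotens_corestr
    (g := tassocV \o tmap idfun (rcoact L) \o cotens_val) cotens_rho_subproof).

(* The coaction is induced by [N ⊗ rcoact L]; this determines it, by
   [tmap_cotens_val_inj]. *)
Lemma cotens_rhoE x :
  tassoc (tmap cotens_val idfun (cotens_rho x)) =
  tmap idfun (rcoact L) (cotens_val x).
Proof.
rewrite /cotens_rho; case: tmap_cotens_corestr => r /= rE.
by rewrite rE tassocVK.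
Qed.

Lemma cotens_rhoP : right_coaction cotens_rho.
Proof.
split=> x; last first.
  apply: cotens_val_inj; rewrite -runit_nat tmap_lr -tmap_rl.
  rewrite -runit_assoc tassoc_natr cotens_rhoE !tmap_compr -[RHS]tmap_id.
  by apply: tmap_ext => // l; rewrite /= (rcoactP L).2.
apply: tmap_cotens_val_inj; apply: (can_inj (@tassocK _ _ _ _)).
have E1 : tmap (tassoc \o tmap cotens_val idfun \o cotens_rho) idfun
    (cotens_rho x) = tmap (tmap idfun (rcoact L) \o cotens_val)
    (idfun : {linear E -> E}) (cotens_rho x).
  by apply: tmap_ext => // y; exact: cotens_rhoE.
rewrite -tassoc_natl tassoc_pentagon !tmap_compl E1.
rewrite -tmap_compl tassoc_natm cotens_rhoE.
rewrite [in RHS]tmap_lr -[in RHS]tmap_rl tassoc_natr cotens_rhoE !tmap_compr.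
by apply: tmap_ext => // l; rewrite /= (rcoactP L).1.
Qed.

Definition cotens_rcomod : rcomod E := RComod cotens_rhoP.

End CotensorRho.

Section CotensorMap.
Variables (D E : coalgebra k) (L : bicomod D E) (N N' : rcomod D).
Variable f : rcomod_hom N N'.

Lemma cotens_fmap_subproof x :
  cotens_map N' L (tmap f idfun (cotens_val N L x)) = 0.
Proof.
rewrite cotens_mapE [X in _ - X]tmap_rl -[X in _ - X]tmap_lr -cotens_valP.
rewrite -tassoc_natl; apply/eqP; rewrite subr_eq0; apply/eqP; congr (tassoc _).
rewrite !tmap_compl.
by apply: tmap_ext => // n; rewrite /= rcomod_funP.
Qed.

Definition cotens_fun : {linear cotens N L -> cotens N' L} :=
  sval (cotens_corestr (g := tmap f idfun \o cotens_val N L) cotens_fmap_subproof).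

(* The restriction of [f ⊗ L]. *)
Lemma cotens_funE x :
  cotens_val N' L (cotens_fun x) = tmap f idfun (cotens_val N L x).
Proof. by rewrite /cotens_fun; case: cotens_corestr => h /= ->. Qed.

Lemma cotens_funP x :
  cotens_rho N' L (cotens_fun x) = tmap cotens_fun idfun (cotens_rho N L x).
Proof.
apply: tmap_cotens_val_inj; rewrite -[LHS]tassocK cotens_rhoE cotens_funE.
rewrite tmap_rl -tmap_lr -cotens_rhoE -tassoc_natl tassocK !tmap_compl.
by apply: tmap_ext => // y; rewrite /= cotens_funE.
Qed.

Definition cotens_fmap : rcomod_hom (cotens_rcomod N L) (cotens_rcomod N' L) :=
  @RComodHom k E (cotens_rcomod N L) (cotens_rcomod N' L) cotens_fun cotens_funP.

End CotensorMap.

(* The functor [- □_D L : M^D -> M^E]. *)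
Definition cotens_functor (D E : coalgebra k) (L : bicomod D E) :
  functor (rcomod_cat D) (rcomod_cat E).
Proof.
refine (@Functor (rcomod_cat D) (rcomod_cat E) (fun N => cotens_rcomod N L)
  (@cotens_fmap D E L) _ _).
  move=> N; apply: rcomod_hom_eq => x; apply: (@cotens_val_inj D E N L).
  by rewrite [LHS]cotens_funE tmap_id.
move=> N N' N'' g f; apply: rcomod_hom_eq => x.
apply: (@cotens_val_inj D E N'' L).
rewrite [LHS]cotens_funE [RHS]cotens_funE [in RHS]cotens_funE.
by rewrite tmap_compl.
Defined.

Section Along.
Variables (C D : coalgebra k) (psi : coalg_hom C D).

Definition psi_l : {linear C -> D ⊗ C} := tmap psi idfun \o comul C.
Definition psi_r : {linear C -> C ⊗ D} := tmap idfun psi \o comul C.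

Lemma psi_lP : left_coaction psi_l.
Proof.
split=> c; last first.
  rewrite /= tmap_compl -[RHS](counitl c); congr (lunit _).
  by apply: tmap_ext => // d; exact: coalg_fun1.
rewrite /= tmap_compl tmap_rl.
rewrite (@tmap_ext _ _ _ _ _ _ (tmap psi psi \o comul C) _ idfun) //; last first.
  by move=> d; rewrite /= coalg_funM.
rewrite -tmap_compl tassoc_nat comulA.
by rewrite tmap_comp; apply: tmap_ext.
Qed.

Lemma psi_rP : right_coaction psi_r.
Proof.
split=> c; last first.
  rewrite /= tmap_compr -[RHS](counitr c); congr (runit _).
  by apply: tmap_ext => // d; exact: coalg_fun1.
rewrite /= tmap_compr tmap_lr.
rewrite (@tmap_ext _ _ _ _ _ idfun idfun (comul D \o psi)
  (tmap psi psi \o comul C)) //;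
  last by move=> d; rewrite /= coalg_funM.
rewrite -tmap_compr -comulA -tassoc_nat tmap_comp.
by congr (tassoc _); apply: tmap_ext.
Qed.

Lemma psi_compat (E : coalgebra k) (f : {linear C -> E})
    (r : {linear C -> C ⊗ E}) : (forall c, r c = tmap idfun f (comul C c)) ->
  forall c, tassoc (tmap psi_l idfun (r c)) = tmap idfun r (psi_l c).
Proof.
move=> rE c; rewrite rE tmap_lr -tmap_rl tassoc_natr /psi_l -tmap_compl.
rewrite tassoc_natl comulA /= !tmap_comp.
by apply: tmap_ext => // d; rewrite /= rE.
Qed.

Lemma comul_left : left_coaction (comul C).
Proof. by split; [exact: comulA|exact: counitl]. Qed.

Lemma comul_right : right_coaction (comul C).
Proof. by split; [exact: comulA|exact: counitr]. Qed.

Lemma psi_comul_compat c :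
  tassoc (tmap psi_l idfun (comul C c)) = tmap idfun (comul C) (psi_l c).
Proof.
by apply: (psi_compat (E := C) (f := idfun)) => d; rewrite tmap_id.
Qed.

Lemma psi_psi_compat c :
  tassoc (tmap psi_l idfun (psi_r c)) = tmap idfun psi_r (psi_l c).
Proof. by apply: (psi_compat (E := D) (f := psi)). Qed.

(* [C] as a [(D, C)]-bicomodule via [(ψ ⊗ C) Δ] and [Δ]. *)
Definition bicomod_DC : bicomod D C :=
  Bicomod psi_lP comul_right psi_comul_compat.

(* [C] as a [(D, D)]-bicomodule via [(ψ ⊗ C) Δ] and [(C ⊗ ψ) Δ]. *)
Definition bicomod_along : bicomod D D :=
  Bicomod psi_lP psi_rP psi_psi_compat.

End Along.

Definition bicomod_self (D : coalgebra k) : bicomod D D :=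
  Bicomod (comul_left D) (comul_right D) (@comulA k D).

Section Psi.
Variables (C D : coalgebra k) (psi : coalg_hom C D).

Lemma psi_bicomod_l c :
  lcoact (bicomod_self D) (psi c) = tmap idfun psi (lcoact (bicomod_along psi) c).
Proof. by rewrite /= coalg_funM tmap_rl. Qed.

Lemma psi_bicomod_r c :
  rcoact (bicomod_self D) (psi c) = tmap psi idfun (rcoact (bicomod_along psi) c).
Proof. by rewrite /= coalg_funM tmap_lr. Qed.

(* [ψ] as a morphism of [D]-bicomodules. *)
Definition psi_bicomod : bicomod_hom (bicomod_along psi) (bicomod_self D) :=
  @BicomodHom k D D (bicomod_along psi) (bicomod_self D) psi
    psi_bicomod_l psi_bicomod_r.

(* The coinduction functor [ψ^* = - □_D C]. *)
Definition coinduction : functor (rcomod_cat D) (rcomod_cat C) :=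
  cotens_functor (bicomod_DC psi).

End Psi.
End CotensorTheory.

(* Main.v *)
Require Import Defs.
From mathcomp Require Import all_boot all_algebra.

Set Implicit Arguments.
Unset Strict Implicit.
Unset Printing Implicit Defensive.

Import GRing.Theory.
Local Open Scope ring_scope.

Local Notation hom := Defs.hom.
Local Notation comp := Defs.comp.

(* The functor [ψ^* = - □_D C] is right adjoint to the corestriction
   [ψ_* : M^C -> M^D]; write [η], [ε] for the unit and the counit.  As for
   Rafael's theorem, [ψ^*] is semiseparable iff there is a natural
   [ν : 1 -> ψ_* ψ^*] with [ε ν ε = ε].  Such [ν] correspond to bicomodule
   morphisms [χ : D -> C]: [ν_N(n) = Σ n_0 ⊗ χ(n_1)] and [χ = (ε_D ⊗ C) ν_D],
   where the left colinearity of [χ] comes from the naturality of [ν] on the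
   cofree comodule [D ⊗ D].  The condition [ε ν ε = ε] becomes
   [ε_C χ ψ = ε_C], which is equivalent to [ψ χ ψ = ψ] because a left colinear
   endomorphism [f] of [D] satisfies [f(d) = Σ d_1 ε_D(f(d_2))]. *)

(** * Semiseparability of a right adjoint *)

Section RightAdjoint.
Variables (A B : category) (F : functor A B) (G : functor B A).
Variables (eta : forall Y : B, hom Y (F (G Y))) (eps : forall X : A, hom (G (F X)) X).

Hypothesis eta_nat : forall (Y Y' : B) (h : hom Y Y'),
  comp (eta Y') h = comp (fmap F (fmap G h)) (eta Y).
Hypothesis eps_nat : forall (X X' : A) (f : hom X X'),
  comp (eps X') (fmap G (fmap F f)) = comp f (eps X).
Hypothesis triangle : forall X : A, comp (fmap F (eps X)) (eta (F X)) = idm (F X).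

(** The correspondence is Yoneda-like: ν_X is P applied to the unit at F(X), and P(h) is recovered
    as ε ∘ G(h) ∘ ν. *)
Lemma semiseparable_right_adjointP :
  semiseparable F <->
  exists2 nu : (forall X : A, hom X (G (F X))),
    forall (X X' : A) (f : hom X X'), comp (nu X') f = comp (fmap G (fmap F f)) (nu X) &
    forall X : A, comp (eps X) (comp (nu X) (eps X)) = eps X.
Proof.
split=> [[P Pnat PF]|[nu nu_nat nu_reg]].
  have Pl X Y Y' (g : hom Y Y') (h : hom (F X) (F Y)) :
      P X Y' (comp (fmap F g) h) = comp g (P X Y h).
    by have := Pnat _ _ _ _ (idm X) g h; rewrite fmap1 !compm1.
  have Pr X X' Y (f : hom X' X) (h : hom (F X) (F Y)) :
      P X' Y (comp h (fmap F f)) = comp (P X Y h) f.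
    by have := Pnat _ _ _ _ f (idm Y) h; rewrite fmap1 !comp1m.
  exists (fun X => P X (G (F X)) (eta (F X))) => [X X' f|X].
    by rewrite -Pr eta_nat Pl.
  (* Naturality of [P] and the triangle identity turn ε ν into P(F(id)). Naturality of ε then moves
     it to the other side of ε, under G F, where F P F = F applies. *)
  rewrite Defs.compA -Pl triangle -{1}(fmap1 F) -eps_nat PF.
  by rewrite fmap1 fmap1 compm1.
exists (fun X Y h => comp (eps Y) (comp (fmap G h) (nu X))).
  move=> X X' Y Y' f g h; rewrite !fmapM -!Defs.compA -nu_nat.
  by rewrite (Defs.compA (eps Y')) eps_nat -!Defs.compA.
move=> X Y f; rewrite Defs.compA eps_nat -Defs.compA fmapM.
(* Precomposing with F(ε) η = id creates the composite ε ν ε inside F. *)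
have -> : fmap F (comp (eps X) (nu X)) = idm (F X).
  rewrite -{1}[fmap F _]compm1 -{1}triangle Defs.compA -fmapM -Defs.compA nu_reg.
  exact: triangle.
by rewrite compm1.
Qed.

End RightAdjoint.

(** * Contracting a tensor factor by a linear form *)

Section Contraction.
Context {k : fieldType}.
Implicit Types U V W : lmodType k.

Lemma tassocV_tens U V W (u : U) (t : V ⊗ W) :
  tassocV (tens u t) = tmap (tens u) idfun t.
Proof. by rewrite tassocV.unlock tliftE. Qed.

Lemma lunit_tassoc U V W (e : {linear U -> k^o}) (x : (U ⊗ V) ⊗ W) :
  lunit (tmap e idfun (tassoc x)) = tmap (lunit \o tmap e idfun) idfun x.
Proof. by rewrite -tassoc_natl lunit_assoc tmap_compl. Qed.

Lemma runit_tassoc U V W (e : {linear V -> k^o}) (x : (U ⊗ V) ⊗ W) :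
  tmap idfun (lunit \o tmap e idfun) (tassoc x) = tmap (runit \o tmap idfun e) idfun x.
Proof.
move: x; apply: (tens_ext3l
  (f := tmap idfun (lunit \o tmap e idfun) \o @tassoc k U V W)) => u v w.
by rewrite /= tassocE !tmapE /= !tmapE lunitE runitE linearZl linearZr.
Qed.

Lemma lunit_runit (x : (k^o : lmodType k) ⊗ k^o) : lunit x = runit x.
Proof.
move: x; apply: tens_ext => a b.
by rewrite lunitE runitE -[LHS]/(a * b) -[RHS]/(b * a) mulrC.
Qed.

End Contraction.

(** * Cofree comodules *)

Section Cofree.
Variables (k : fieldType) (D : coalgebra k).

Definition rcomod_self : rcomod D := RComod (comul_right D).

Variable V : lmodType k.

Definition cofree_rho : {linear V ⊗ D -> (V ⊗ D) ⊗ D} :=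
  tassocV \o tmap idfun (comul D).

Lemma cofree_rhoE v d : cofree_rho (tens v d) = tmap (tens v) idfun (comul D d).
Proof. by rewrite /cofree_rho /= tmapE tassocV_tens. Qed.

Lemma cofree_rhoP : right_coaction cofree_rho.
Proof.
split.
  apply: (tens_ext (f := tassoc \o tmap cofree_rho idfun \o cofree_rho)
    (g := tmap idfun (comul D) \o cofree_rho)) => v d.
  rewrite /= [tassocV _]cofree_rhoE tmap_compl.
  rewrite (@tmap_ext _ _ _ _ _ _ (tmap (tens v) idfun \o comul D) idfun idfun) //;
    last by move=> c; exact: cofree_rhoE.
  by rewrite -tmap_compl tassoc_natl comulA tmap_lr tmap_rl.
apply: (tens_ext (f := runit \o tmap idfun (counit D) \o cofree_rho)
  (g := idfun)) => v d.
by rewrite /= [tassocV _]cofree_rhoE tmap_rl -tmap_lr runit_nat counitr.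
Qed.

Definition cofree : rcomod D := RComod cofree_rhoP.

(** Naturality along these maps, whose images span V ⊗ D, determines ν on a cofree comodule from ν
    on D. *)
Definition cofree_tens (v : V) : rcomod_hom rcomod_self cofree :=
  @RComodHom _ _ rcomod_self cofree (tens v) (cofree_rhoE v).

End Cofree.

Section CofreeComul.
Variables (k : fieldType) (D : coalgebra k).

Lemma cofree_comulP d :
  cofree_rho D D (comul D d) = tmap (comul D) idfun (comul D d).
Proof. by rewrite /cofree_rho /= -comulA tassocK. Qed.

Definition cofree_comul : rcomod_hom (rcomod_self D) (cofree D D) :=
  @RComodHom _ _ (rcomod_self D) (cofree D D) (comul D) cofree_comulP.

End CofreeComul.

(* [D □_D L] is isomorphic to [L], through the counit of [D] in one direction
   and the left coaction of [L] in the other. *)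
Section CotensSelf.
Variables (k : fieldType) (D E : coalgebra k) (L : bicomod D E).
Local Notation D_L := (cotens (rcomod_self D) L).

Definition cotens_self : {linear D_L -> L} :=
  lunit \o tmap (counit D) idfun \o cotens_val (rcomod_self D) L.

(** The cotensor condition trades the coaction of L for the comultiplication of the factor D, which
    the counit then cancels. *)
Lemma cotens_selfK y : lcoact L (cotens_self y) = cotens_val (rcomod_self D) L y.
Proof.
rewrite /cotens_self /= -lunit_nat tmap_rl -tmap_lr -(cotens_valP y) lunit_tassoc.
rewrite tmap_compl -[RHS]tmap_id.
by apply: tmap_ext => // d; exact: counitl.
Qed.

Lemma cotens_self_rcoact y :
  rcoact L (cotens_self y) = tmap cotens_self idfun (cotens_rho (rcomod_self D) L y).
Proof.
rewrite /cotens_self -tmap_compl -lunit_tassoc (cotens_rhoE y).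
by rewrite /= -lunit_nat tmap_rl tmap_lr.
Qed.

(** Coassociativity of the left coaction is exactly the cotensor condition for its values. *)
Lemma cotens_self_surj l : exists y, cotens_val (rcomod_self D) L y = lcoact L l.
Proof.
have [|h hE] := @cotens_corestr _ _ _ (rcomod_self D) L _ (lcoact L);
  last by exists (h l).
by move=> m; rewrite cotens_mapE (lcoactP L).1 subrr.
Qed.

End CotensSelf.

(** * The adjunction between corestriction and coinduction *)

Section Corestriction.
Variables (k : fieldType) (C D : coalgebra k) (psi : coalg_hom C D).

Section Obj.
Variable M : rcomod C.

Definition corestr_rho : {linear M -> M ⊗ D} := tmap idfun psi \o rho M.

Lemma corestr_rhoP : right_coaction corestr_rho.
Proof.
split=> m; last first.
  rewrite /= tmap_compr -[RHS](rhoP M).2; congr (runit _).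
  by apply: tmap_ext => // d; exact: coalg_fun1.
rewrite /= tmap_compr tmap_lr.
rewrite [RHS](@tmap_ext _ _ _ _ _ idfun idfun _ (tmap psi psi \o comul C)) //;
  last by move=> d; rewrite /= coalg_funM.
rewrite -tmap_rl tassoc_natr /corestr_rho -tmap_compl tassoc_natm (rhoP M).1.
rewrite !tmap_compr; apply: tmap_ext => // c; exact: tmap_rl.
Qed.

Definition corestr : rcomod D := RComod corestr_rhoP.
End Obj.

Section Map.
Variables (M N : rcomod C) (f : rcomod_hom M N).

Lemma corestr_funP m :
  rho (corestr N) (f m) = tmap f idfun (rho (corestr M) m).
Proof. by rewrite /= /corestr_rho /= rcomod_funP tmap_rl tmap_lr. Qed.

Definition corestr_fmap : rcomod_hom (corestr M) (corestr N) :=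
  @RComodHom _ _ (corestr M) (corestr N) f corestr_funP.
End Map.

Definition corestriction : functor (rcomod_cat C) (rcomod_cat D).
Proof.
by refine (@Functor (rcomod_cat C) (rcomod_cat D) corestr corestr_fmap _ _) => *;
  apply: rcomod_hom_eq.
Defined.

Local Notation CC := (bicomod_DC psi).

(** This is coassociativity with ψ applied to the middle factor; it lets the coaction of M itself
    serve as the unit. *)
Lemma coind_unit_subproof (M : rcomod C) m : cotens_map (corestr M) CC (rho M m) = 0.
Proof.
by rewrite cotens_mapE /= -tmap_compl tassoc_natm (rhoP M).1 tmap_compr subrr.
Qed.

Definition coind_unit_fun (M : rcomod C) : {linear M -> cotens (corestr M) CC} :=
  sval (cotens_corestr (coind_unit_subproof (M := M))).

Lemma coind_unitE M m : cotens_val (corestr M) CC (coind_unit_fun M m) = rho M m.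
Proof. by rewrite /coind_unit_fun; case: cotens_corestr => h /= ->. Qed.

Lemma coind_unitP M m :
  cotens_rho (corestr M) CC (coind_unit_fun M m) = tmap (coind_unit_fun M) idfun (rho M m).
Proof.
apply: tmap_cotens_val_inj; apply: (can_inj (@tassocK _ _ _ _)).
rewrite cotens_rhoE coind_unitE -(rhoP M).1 tmap_compl; congr (tassoc _).
by apply: tmap_ext => // x; rewrite /= coind_unitE.
Qed.

Definition coind_unit (M : rcomod C) : rcomod_hom M (cotens_rcomod (corestr M) CC) :=
  @RComodHom _ _ M (cotens_rcomod (corestr M) CC) (coind_unit_fun M) (@coind_unitP M).

Definition coind_counit_fun (N : rcomod D) : {linear cotens N CC -> N} :=
  runit \o tmap idfun (counit C) \o cotens_val N CC.

(** For y = Σ n ⊗ c both sides reduce to Σ n ⊗ ψ(c): the left one by the cotensor condition and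
    ψ(c_1) ε(c_2), the right one by ε(c_1) ψ(c_2). *)
Lemma coind_counitP N y : rho N (coind_counit_fun N y) =
  tmap (coind_counit_fun N) idfun (rho (corestr (cotens_rcomod N CC)) y).
Proof.
rewrite /= /corestr_rho /= tmap_lr -tmap_rl -tmap_compl -runit_tassoc (cotens_rhoE y).
rewrite -runit_nat -runit_assoc tmap_lr -[X in tassoc X]tmap_rl tassoc_natr.
rewrite (cotens_valP y) !tmap_compr.
apply: tmap_ext => // c.
by rewrite /= counitl tmap_rl -tmap_lr runit_nat counitr.
Qed.

Definition coind_counit (N : rcomod D) : rcomod_hom (corestr (cotens_rcomod N CC)) N :=
  @RComodHom _ _ (corestr (cotens_rcomod N CC)) N (coind_counit_fun N) (@coind_counitP N).

Lemma coind_unit_nat (M M' : rcomod C) (h : rcomod_hom M M') :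
  rcomod_comp (coind_unit M') h =
  rcomod_comp (cotens_fmap CC (corestr_fmap h)) (coind_unit M).
Proof.
apply: rcomod_hom_eq => x; apply: cotens_val_inj.
by rewrite [LHS]coind_unitE [RHS]cotens_funE coind_unitE rcomod_funP.
Qed.

Lemma coind_counit_nat (N N' : rcomod D) (f : rcomod_hom N N') :
  rcomod_comp (coind_counit N') (corestr_fmap (cotens_fmap CC f)) =
  rcomod_comp f (coind_counit N).
Proof.
apply: rcomod_hom_eq => y.
by rewrite /= /coind_counit_fun /= cotens_funE tmap_rl -tmap_lr runit_nat.
Qed.

Lemma coind_triangle (N : rcomod D) :
  rcomod_comp (cotens_fmap CC (coind_counit N)) (coind_unit (cotens_rcomod N CC)) =
  rcomod_id (cotens_rcomod N CC).
Proof.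
apply: rcomod_hom_eq => y; apply: cotens_val_inj.
rewrite [LHS]cotens_funE coind_unitE /= /coind_counit_fun -tmap_compl -runit_tassoc.
rewrite (cotens_rhoE y) tmap_compr -[RHS]tmap_id.
by apply: tmap_ext => // c; exact: counitl.
Qed.

(** * From a bicomodule morphism χ to a natural ν *)

Section OfHom.
Variable chi : bicomod_hom (bicomod_self D) (bicomod_along psi).
Variable N : rcomod D.

(** Left colinearity of χ is what places Σ n_0 ⊗ χ(n_1) in the cotensor product; right colinearity
    will make ν_N a comodule map. *)
Lemma hom_section_subproof x : cotens_map N CC (tmap idfun chi (rho N x)) = 0.
Proof.
rewrite cotens_mapE tmap_lr -[X in tassoc X]tmap_rl tassoc_natr (rhoP N).1 !tmap_compr.
apply/eqP; rewrite subr_eq0; apply/eqP.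
by apply: tmap_ext => // d; rewrite /= -(bicomod_funl chi).
Qed.

Definition hom_section_fun : {linear N -> cotens N CC} :=
  sval (cotens_corestr (L := CC) (g := tmap idfun chi \o rho N) hom_section_subproof).

Lemma hom_sectionE x : cotens_val N CC (hom_section_fun x) = tmap idfun chi (rho N x).
Proof. by rewrite /hom_section_fun; case: cotens_corestr => h /= ->. Qed.

Lemma hom_sectionP x : rho (corestr (cotens_rcomod N CC)) (hom_section_fun x) =
  tmap hom_section_fun idfun (rho N x).
Proof.
apply: tmap_cotens_val_inj; apply: (can_inj (@tassocK _ _ _ _)).
rewrite /= /corestr_rho /= tmap_lr -tmap_rl tassoc_natr.
rewrite (cotens_rhoE (hom_section_fun x)) hom_sectionE.
rewrite tmap_compl (@tmap_ext _ _ _ _ _ _ (tmap idfun chi \o rho N) idfun idfun) //;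
  last exact: hom_sectionE.
rewrite -tmap_compl tassoc_natm (rhoP N).1 !tmap_compr.
by apply: tmap_ext => // d; rewrite /= -(bicomod_funr chi).
Qed.

Definition hom_section : rcomod_hom N (corestr (cotens_rcomod N CC)) :=
  @RComodHom _ _ N (corestr (cotens_rcomod N CC)) hom_section_fun hom_sectionP.

Lemma coind_counit_sectionE x : coind_counit_fun N (hom_section_fun x) =
  runit (tmap idfun (counit C \o chi) (rho N x)).
Proof. by rewrite /coind_counit_fun /= hom_sectionE tmap_compr. Qed.

(** Colinearity of the counit ε_N gives ε_N ν_N ε_N(y) = Σ ε_N(y_0) ε_C(χ(ψ(y_1))). The hypothesis
    replaces the scalar by ε_C(y_1), and counitality of the cotensor comodule finishes. *)
Lemma hom_section_regular :
  (forall c, counit C (chi (psi c)) = counit C c) ->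
  rcomod_comp (coind_counit N) (rcomod_comp hom_section (coind_counit N)) =
  coind_counit N.
Proof.
move=> chiK; apply: rcomod_hom_eq => y.
rewrite -[LHS]/(coind_counit_fun N (hom_section_fun (coind_counit_fun N y))).
rewrite coind_counit_sectionE coind_counitP /=.
rewrite /corestr_rho tmap_lr tmap_comp.
rewrite (@tmap_ext _ _ _ _ _ _ (coind_counit_fun N) _ (counit C)) //.
by rewrite -tmap_lr runit_nat (cotens_rhoP N CC).2.
Qed.

End OfHom.

Lemma hom_section_nat chi (N N' : rcomod D) (f : rcomod_hom N N') :
  rcomod_comp (hom_section chi N') f =
  rcomod_comp (corestr_fmap (cotens_fmap CC f)) (hom_section chi N).
Proof.
apply: rcomod_hom_eq => x; apply: cotens_val_inj.
by rewrite [LHS]hom_sectionE [RHS]cotens_funE hom_sectionE rcomod_funP tmap_rl tmap_lr.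
Qed.

(** * From a natural ν to a bicomodule morphism χ *)

Section OfSection.
Variable nu : forall N : rcomod D, rcomod_hom N (corestr (cotens_rcomod N CC)).
Hypothesis nu_nat : forall (N N' : rcomod D) (f : rcomod_hom N N'),
  rcomod_comp (nu N') f = rcomod_comp (corestr_fmap (cotens_fmap CC f)) (nu N).

Definition section_hom_fun : {linear D -> C} :=
  cotens_self CC \o nu (rcomod_self D).

Local Notation val N := (cotens_val N CC).

Lemma section_natE (N N' : rcomod D) (f : rcomod_hom N N') x :
  val N' (nu N' (f x)) = tmap f idfun (val N (nu N x)).
Proof.
have := congr1 (fun g : rcomod_hom N (corestr (cotens_rcomod N' CC)) =>
  val N' (g x)) (nu_nat f).
by move=> E; rewrite -(cotens_funE f); exact: E.
Qed.

Lemma section_cofreeE (V : lmodType k) x : val (cofree D V) (nu (cofree D V) x) =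
  tassocV (tmap idfun (val (rcomod_self D) \o nu (rcomod_self D)) x).
Proof.
move: x; apply: (tens_ext (f := val (cofree D V) \o nu (cofree D V))
  (g := tassocV \o tmap idfun (val (rcomod_self D) \o nu (rcomod_self D)))) => v d.
rewrite /= tmapE tassocV_tens; exact: (section_natE (cofree_tens D v)).
Qed.

(** Naturality of ν along the colinear map Δ : D -> D ⊗ D compares ν on this cofree comodule with
    ν_D. Left colinearity of χ follows, since [cotens_selfK] identifies the left side with the left
    coaction of χ(d). *)
Lemma section_homE d :
  val (rcomod_self D) (nu (rcomod_self D) d) = tmap idfun section_hom_fun (comul D d).
Proof.
have := section_natE (cofree_comul D) d; rewrite section_cofreeE.
(* Contract the middle factor of D ⊗ D ⊗ C: one side becomes Σ d_1 ⊗ χ(d_2), the other ν_D(d). *)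
move=> /(congr1 (tmap idfun (lunit \o tmap (counit D) idfun) \o tassoc)).
rewrite /= tassocVK tmap_compr runit_tassoc tmap_compl => E.
rewrite [RHS](tmap_ext (g' := (lunit \o tmap (counit D) idfun) \o
  (val (rcomod_self D) \o nu (rcomod_self D))) (frefl _)) // E -[LHS]tmap_id.
by apply: tmap_ext => // c; rewrite /= counitr.
Qed.

Lemma section_hom_l d : lcoact (bicomod_along psi) (section_hom_fun d) =
  tmap idfun section_hom_fun (lcoact (bicomod_self D) d).
Proof. by rewrite -section_homE; exact: (@cotens_selfK _ _ _ CC). Qed.

(** Both ν_D and the contraction of D □_D C onto C are right colinear. *)
Lemma section_hom_r d : rcoact (bicomod_along psi) (section_hom_fun d) =
  tmap section_hom_fun idfun (rcoact (bicomod_self D) d).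
Proof.
rewrite /section_hom_fun /= -tmap_compl -(rcomod_funP (nu (rcomod_self D))).
rewrite [rho _]/= /corestr_rho [RHS]tmap_lr -[RHS]tmap_rl.
congr (tmap idfun psi _); exact: (@cotens_self_rcoact _ _ _ CC).
Qed.

Definition section_hom : bicomod_hom (bicomod_self D) (bicomod_along psi) :=
  @BicomodHom _ _ _ (bicomod_self D) (bicomod_along psi) section_hom_fun
    section_hom_l section_hom_r.

Lemma section_hom_counit :
  rcomod_comp (coind_counit (rcomod_self D))
    (rcomod_comp (nu (rcomod_self D)) (coind_counit (rcomod_self D))) =
  coind_counit (rcomod_self D) ->
  forall c, counit C (section_hom (psi c)) = counit C c.
Proof.
(* Here y = Σ ψ(c_1) ⊗ c_2, a preimage of ψ(c) under the adjunction counit; hence ψ(c) is fixed by ε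
   ν. *)
move=> nuK c; have [y yE] := @cotens_self_surj _ _ _ CC c.
have epsy : coind_counit (rcomod_self D) y = psi c.
  by rewrite /= /coind_counit_fun /= yE tmap_rl -tmap_lr runit_nat counitr.
have nuK_psi : coind_counit (rcomod_self D) (nu (rcomod_self D) (psi c)) = psi c.
  have E := congr1 (fun g : rcomod_hom (corestr (cotens_rcomod (rcomod_self D) CC))
    (rcomod_self D) => g y) nuK.
  by rewrite -epsy; exact: E.
(* With ε_C(c) written as ε_D(ψ(c)), both sides apply ε_D ⊗ ε_C to ν_D(ψ(c)), contracting the
   factors in opposite orders. *)
rewrite -[RHS](coalg_fun1 psi) -[in RHS]nuK_psi.
rewrite /= /coind_counit_fun /section_hom_fun /cotens_self /= -lunit_nat -runit_nat.
by rewrite tmap_rl tmap_lr lunit_runit.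
Qed.

End OfSection.

Lemma coinduction_semiseparableP :
  semiseparable (coinduction psi) <->
  exists chi : bicomod_hom (bicomod_self D) (bicomod_along psi),
    forall c : C, counit C (chi (psi c)) = counit C c.
Proof.
rewrite (@semiseparable_right_adjointP _ _ (coinduction psi) corestriction
  coind_unit coind_counit coind_unit_nat coind_counit_nat coind_triangle).
split=> [[nu nu_nat nuK]|[chi chiK]].
  by exists (section_hom nu_nat); exact: section_hom_counit (nuK (rcomod_self D)).
exists (hom_section chi); first exact: hom_section_nat.
by move=> N; exact: hom_section_regular.
Qed.

End Corestriction.

(** * Regularity of ψ in terms of counits *)

Lemma bicomod_self_homE (k : fieldType) (D : coalgebra k)
    (f : bicomod_hom (bicomod_self D) (bicomod_self D)) d :
  f d = runit (tmap idfun (counit D \o f) (comul D d)).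
Proof. by rewrite -tmap_compr -(bicomod_funl f) /= counitr. Qed.

(** The same χ serves in both directions; the forward one applies ε_D to ψ χ ψ = ψ and uses ε_D ψ =
    ε_C. *)
Lemma psi_regularP (k : fieldType) (C D : coalgebra k) (psi : coalg_hom C D) :
  regular (A := bicomod_cat D D) (psi_bicomod psi) <->
  exists chi : bicomod_hom (bicomod_self D) (bicomod_along psi),
    forall c : C, counit C (chi (psi c)) = counit C c.
Proof.
split=> -[chi chiK]; exists chi.
  move=> c; have E := congr1 (fun g : bicomod_hom (bicomod_along psi)
    (bicomod_self D) => counit D (g c)) chiK.
  by rewrite -[LHS](coalg_fun1 psi) -[RHS](coalg_fun1 psi); exact: E.
apply: bicomod_hom_eq => c.
(* The endomorphism ψ χ of D is determined by ε_D ψ χ = ε_C χ, which is known on the image of ψ;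
   Δ(ψ(c)) = Σ ψ(c_1) ⊗ ψ(c_2) brings it there. *)
rewrite -[LHS]/(bicomod_comp (psi_bicomod psi) chi (psi c)) bicomod_self_homE.
rewrite coalg_funM tmap_comp /= -[RHS]/(psi c) -{2}(counitr c) -runit_nat tmap_lr.
congr (runit _); apply: tmap_ext => // x.
by rewrite /= coalg_fun1 chiK.
Qed.

Theorem proposition3p8 (k : fieldType) (C D : coalgebra k)
    (psi : coalg_hom C D) :
  (semiseparable (coinduction psi) <->
   regular (A := bicomod_cat D D) (psi_bicomod psi)) /\
  (regular (A := bicomod_cat D D) (psi_bicomod psi) <->
   exists chi : bicomod_hom (bicomod_self D) (bicomod_along psi),
     forall c : C, counit C (chi (psi c)) = counit C c).
Proof.
split; last exact: psi_regularP.
by rewrite psi_regularP; exact: coinduction_semiseparableP.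
Qed.
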